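(* Suppose $L$ is a simplicial complex with vertex set $I$ and $(\mathbf M,\boldsymbol\partial\mathbf M)=\{(M(i),\partial M(i))\}_{i\in I}$ is a collection of path connected manifolds with (nonempty) boundary. If $L$ is a triangulation of a sphere, then the polyhedral product $\mathcal Z_L(\mathbf M,\boldsymbol\partial\mathbf M)$ is a closed manifold.
   Context: Polyhedral product: let $\mathcal S(L)$ be the poset of vertex sets of simplices of $L$, including $\emptyset$. For a family of pairs $(\mathbf A,\mathbf B)=\{(A(i),B(i))\}_{i\in I}$ and $\mathbf x\in\prod_{i\in I}A(i)$ put $\operatorname{Supp}(\mathbf x)=\{i\mid x_i\in A(i)-B(i)\}$. Then $\mathcal Z_L(\mathbf A,\mathbf B)=\{\mathbf x\in\prod_{i\in I}A(i)\mid\operatorname{Supp}(\mathbf x)\in\mathcal S(L)\}$. Here $(A(i),B(i))=(M(i),\partial M(i))$.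
   Formalization: The polyhedral product is shown to be a manifold without boundary in general, and compact (closed) when every M(i) is compact; without compactness the claim fails, e.g. L two points and M(i)=[0,∞) give the non-compact line. *)

(* Defs.v *)
From HB Require Import structures.
From mathcomp Require Import all_boot all_order all_algebra.
From mathcomp Require Import all_classical all_reals all_analysis.

Set Implicit Arguments.
Unset Strict Implicit.
Unset Printing Implicit Defensive.

Import Order.TTheory GRing.Theory Num.Theory.
Import numFieldNormedType.Exports.

Local Open Scope classical_set_scope.
Local Open Scope ring_scope.

(* [f] restricts to a homeomorphism from [A] onto [B], both with the subspace
   topology; the values of [f] outside [A] are irrelevant. *)
Definition homeomorphism (X Y : topologicalType) (A : set X) (B : set Y)
    (f : X -> Y) : Prop :=
  exists g : Y -> X,
    [/\ forall x, A x -> B (f x) /\ g (f x) = x,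
        forall y, B y -> A (g y) /\ f (g y) = y,
        {within A, continuous f} & {within B, continuous g}].

Definition homeomorphic (X Y : topologicalType) (A : set X) (B : set Y) : Prop :=
  exists f : X -> Y, homeomorphism A B f.

Definition path_connected (R : realType) (T : topologicalType) : Prop :=
  forall x y : T, exists gamma : R -> T,
    [/\ {within `[0, 1], continuous gamma}, gamma 0 = x & gamma 1 = y].

Definition topological_manifold (R : realType) (n : nat) (T : topologicalType)
    : Prop :=
  [/\ hausdorff_space T, @second_countable T
    & forall x : T, exists (U : set T) (V : set 'rV[R]_n),
        [/\ open U, U x, open V & homeomorphic U V]].

Definition closed_manifold (R : realType) (n : nat) (T : topologicalType)
    : Prop :=
  topological_manifold R n T /\ compact [set: T].

(* The first coordinate is the constrained one. Quantifying over [j] makes the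
   definitions meaningful for n = 0, where the half-space is a point and its
   boundary is empty. *)
Definition half_space (R : realType) (n : nat) : set 'rV[R]_n :=
  [set v | forall j : 'I_n, j = 0%N :> nat -> 0 <= v ord0 j].
Arguments half_space : clear implicits.

Definition half_space_boundary (R : realType) (n : nat) : set 'rV[R]_n :=
  [set v | exists j : 'I_n, j = 0%N :> nat /\ v ord0 j = 0].
Arguments half_space_boundary : clear implicits.

Definition half_space_chart (R : realType) (n : nat) (T : topologicalType)
    (U : set T) (f : T -> 'rV[R]_n) : Prop :=
  open U /\
  exists2 O : set 'rV[R]_n, open O & homeomorphism U (O `&` half_space R n) f.

Definition manifold_with_boundary (R : realType) (n : nat)
    (T : topologicalType) : Prop :=
  [/\ hausdorff_space T, @second_countable T
    & forall x : T, exists (U : set T) (f : T -> 'rV[R]_n),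
        U x /\ half_space_chart U f].

Definition manifold_boundary (R : realType) (n : nat) (T : topologicalType)
    : set T :=
  [set x | exists (U : set T) (f : T -> 'rV[R]_n),
    [/\ U x, half_space_chart U f & half_space_boundary R n (f x)]].
Arguments manifold_boundary : clear implicits.

(* A complex is given by the poset of vertex sets of its simplices, the empty
   simplex included. *)
Definition simplicial_complex (I : finType) (L : {set {set I}}) : Prop :=
  [/\ finset.set0 \in L,
      forall s t : {set I}, s \in L -> t \subset s -> t \in L
    & forall i : I, finset.set1 i \in L].

(* The points of |L| are given by their barycentric coordinates. *)
Definition geometric_realization (R : realType) (I : finType)
    (L : {set {set I}}) : set {ptws I -> R} :=
  [set t | [/\ forall i, 0 <= t i, \sum_i t i = 1
             & finset (fun i => t i != 0) \in L]].
Arguments geometric_realization R {I} L _.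

(* The sphere S^(n-1); the library norm on row vectors is the sup norm. *)
Definition euclidean_sphere (R : realType) (n : nat) : set 'rV[R]_n :=
  [set v | \sum_j v ord0 j ^+ 2 = 1].
Arguments euclidean_sphere : clear implicits.

(* For n = 0 this is the usual convention that the complex whose only simplex
   is empty triangulates the empty sphere S^(-1). *)
Definition triangulates_sphere (R : realType) (I : finType)
    (L : {set {set I}}) : Prop :=
  exists n : nat,
    homeomorphic (geometric_realization R L) (euclidean_sphere R n).

Definition Supp (I : finType) (A : I -> Type) (B : forall i, set (A i))
    (x : forall i, A i) : {set I} :=
  finset (fun i => x i \notin B i).

Definition polyhedral_product (I : finType) (L : {set {set I}})
    (A : I -> topologicalType) (B : forall i, set (A i))
    : set (prod_topology A) :=
  [set x | Supp B x \in L].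

(* Main.v *)
(* Near a point x of Z choose half-space charts of the M(i), and call the first
   coordinate of the i-th chart the i-th height. By invariance of the boundary
   the heights t satisfy supp t = Supp, so the points of Z near x are described
   by an arbitrary choice of the remaining chart coordinates together with a
   point of the cone {t >= 0 | supp t in L}. This cone is the open cone on |L|,
   a sphere S^(n-1), hence is homeomorphic to R^n; thus Z is locally Euclidean of
   dimension n + sum (m i - 1). Links of simplices, which need not be spheres,
   never enter.
   Invariance of the boundary: if an interior point p corresponded to a boundary
   point under a change of charts, pushing into the half-space by eps would give
   a self-map of a cube around p that is close to the identity but misses p,
   contradicting the Poincare-Miranda theorem. The latter follows from a grid
   version: if a_i is a 0/1 labelling equal to 0 and 1 on the two faces orthogonal
   to direction i, then by Stokes the mod 2 cup product of the coboundaries of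
   the a_i has sum 1 over the grid cubes, so it is nonzero on some cube, and
   every a_i is nonconstant there. *)
Require Import Defs.
From mathcomp Require Import all_boot all_order all_algebra.
From mathcomp Require Import all_classical all_reals all_analysis.
From mathcomp Require Import lra.

Set Implicit Arguments.
Unset Strict Implicit.
Unset Printing Implicit Defensive.

Import Order.TTheory GRing.Theory Num.Theory.
Import numFieldNormedType.Exports.

Local Open Scope ring_scope.

(** * A discrete Poincare-Miranda theorem *)

Lemma F2_addrr (x : 'F_2) : x + x = 0.
Proof. by apply: addrr_pchar2; rewrite pchar_Fp. Qed.

Section GridDegree.
Variable I : finType.
Implicit Types (v w : I -> nat) (S : {set I}) (a : (I -> nat) -> 'F_2) (s : seq I).

Definition step v (j : I) : I -> nat := fun i => (v i + (i == j))%N.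
Definition upd v (j : I) (k : nat) : I -> nat := fun i => if i == j then k else v i.

(* Cup product of the coboundaries of the functions in [l], evaluated on the
   cube with lowest vertex [v] and set of directions [S]: a sum over the monotone
   edge paths from [v] to the opposite vertex. *)
Fixpoint cup (l : seq ((I -> nat) -> 'F_2)) S v : 'F_2 :=
  if l is a :: l' then
    \sum_(j in S) (a (step v j) + a v) * cup l' (S :\ j) (step v j)
  else (S == finset.set0)%:R.

(** The terms at [(j, k)] and [(k, j)] are equal and cancel in characteristic 2; [enum_rank] only
    picks one of each pair. *)
Lemma sum_sym0 S (g : I -> I -> 'F_2) : (forall j k, g j k = g k j) ->
  \sum_(j in S) \sum_(k in S :\ j) g j k = 0.
Proof.
move=> gC; rewrite (eq_bigr (fun j =>
  \sum_(k in S | (enum_rank k < enum_rank j)%N) g j k +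
  \sum_(k in S | (enum_rank j < enum_rank k)%N) g j k)); last first.
  move=> j jS; rewrite (bigID (fun k => (enum_rank k < enum_rank j)%N)) /=.
  congr (_ + _); apply: eq_bigl => k; rewrite !inE.
    by case: eqVneq => [->|]; rewrite ?ltnn ?andbF ?andbT.
  have [->|kj] /= := eqVneq k j; first by rewrite ltnn andbF.
  congr (_ && _); rewrite -leqNgt leq_eqVlt; case: eqP => // /val_inj/enum_rank_inj jk.
  by rewrite jk eqxx in kj.
rewrite big_split /= [X in X + _](exchange_big_dep (mem S)) /=;
  last by move=> j k _ /andP[].
rewrite -[RHS](F2_addrr (\sum_(j in S) \sum_(k in S | (enum_rank j < enum_rank k)%N) g j k)).
congr (_ + _); apply: eq_bigr => j jS; by apply: eq_big => [k|k _]; rewrite ?jS // gC.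
Qed.

Lemma step_comm v j k : step (step v j) k = step (step v k) j.
Proof. by apply: funext => i; rewrite /step addnAC. Qed.

(* A cup product of cocycles is a cocycle: its values on the facets of a cube
   cancel. *)
Lemma cup_closed l S v :
  \sum_(j in S) (cup l (S :\ j) (step v j) + cup l (S :\ j) v) = 0.
Proof.
elim: l S v => [|a l IH] S v /=; first by apply: big1 => j _; exact: F2_addrr.
have setDC T (j k : I) : (T :\ j) :\ k = (T :\ k) :\ j.
  by apply/finset.setP => i; rewrite !inE andbCA.
pose c j k u := cup l ((S :\ j) :\ k) u.
have cC j k u : c j k u = c k j u by rewrite /c setDC.
(* In the four sums [a] is evaluated at the far vertex, at [step v j], at [step v k] and at [v]. The
   first and last vanish by symmetry and the middle two cancel, once the induction hypothesis has
   moved the argument of [c] in the second and fourth. *)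
rewrite (eq_bigr (fun j =>
  \sum_(k in S :\ j) a (step (step v j) k) * c j k (step (step v j) k) +
  \sum_(k in S :\ j) a (step v j) * c j k (step (step v j) k) +
  (\sum_(k in S :\ j) a (step v k) * c j k (step v k) +
   \sum_(k in S :\ j) a v * c j k (step v k))));
  last first.
  by move=> j _; rewrite -!big_split /=; apply: eq_bigr => k _; rewrite !mulrDl.
rewrite !big_split /= sum_sym0 ?add0r; last first.
  by move=> j k; rewrite step_comm cC.
rewrite addrA.
have sw (g : I -> I -> 'F_2) : \sum_(j in S) \sum_(k in S :\ j) g j k =
    \sum_(j in S) \sum_(k in S :\ j) g k j.
  rewrite (exchange_big_dep (mem S)) /=; last by move=> j k _; rewrite !inE => /andP[].
  by apply: eq_bigr => j jS; apply: eq_bigl => k; rewrite !inE jS andbT eq_sym andbC.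
have IH' j : j \in S ->
  \sum_(k in S :\ j) c j k (step (step v j) k) = \sum_(k in S :\ j) c j k (step v j).
  move=> jS; apply/eqP; rewrite -subr_eq0 oppr_pchar2 ?pchar_Fp // -big_split.
  by apply/eqP; apply: IH.
rewrite [X in _ + X + _]sw -big_split /= big1 ?add0r; last first.
  move=> j jS; rewrite -!mulr_sumr IH' //.
  have -> : \sum_(k in S :\ j) c k j (step v j) = \sum_(k in S :\ j) c j k (step v j).
    by apply: eq_bigr => k _; rewrite cC.
  exact: F2_addrr.
rewrite (eq_bigr (fun j => \sum_(k in S :\ j) a v * c j k v)); last first.
  move=> j jS; rewrite -!mulr_sumr; congr (_ * _).
  apply/eqP; rewrite -subr_eq0 oppr_pchar2 ?pchar_Fp // -big_split.
  by apply/eqP; apply: IH.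
by rewrite sum_sym0 // => j k; rewrite cC.
Qed.

(** Since [cup l] is a cocycle, its product with the coboundary of [a] is again a coboundary, the
    form in which sums over a box telescope. *)
Lemma cup_cons a l S v : cup (a :: l) S v =
  \sum_(j in S) (a (step v j) * cup l (S :\ j) (step v j) + a v * cup l (S :\ j) v).
Proof.
rewrite /=; under eq_bigr do rewrite mulrDl.
rewrite !big_split /=; congr (_ + _).
rewrite -!mulr_sumr; congr (_ * _).
apply/eqP; rewrite -subr_eq0 oppr_pchar2 ?pchar_Fp // -big_split.
by apply/eqP/cup_closed.
Qed.

(** * Sums over a grid box and the mod 2 Stokes formula *)

Variable N : nat.

(** Coordinates outside [s] keep their values from [v], so sums over faces of the box have the same
    form. *)
Fixpoint boxsum s (g : (I -> nat) -> 'F_2) v : 'F_2 :=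
  if s is j :: s' then \sum_(k < N) boxsum s' g (upd v j k) else g v.

Lemma boxsumD s g h v :
  boxsum s (fun u => g u + h u) v = boxsum s g v + boxsum s h v.
Proof.
by elim: s v => //= j s IH v; rewrite -big_split; apply: eq_bigr => k _; rewrite IH.
Qed.

Lemma boxsum_sum s (S : {set I}) (G : I -> (I -> nat) -> 'F_2) v :
  boxsum s (fun u => \sum_(j in S) G j u) v = \sum_(j in S) boxsum s (G j) v.
Proof.
elim: s v => //= j s IH v; rewrite exchange_big /=; apply: eq_bigr => k _; exact: IH.
Qed.

Lemma step_upd v j k i : i != j -> step (upd v j k) i = upd (step v i) j k.
Proof.
move=> ij; apply: funext => x; rewrite /step /upd; case: (eqVneq x j) => // ->.
by rewrite eq_sym (negPf ij) addn0.
Qed.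

Lemma boxsum_step s g v j : j \notin s ->
  boxsum s (fun u => g (step u j)) v = boxsum s g (step v j).
Proof.
elim: s v => //= i s IH v; rewrite inE negb_or => /andP[ji js].
by apply: eq_bigr => k _; rewrite IH // step_upd.
Qed.

(** The sum telescopes in direction [j]; modulo 2 the difference of the two end faces is their
    sum. *)
Lemma boxsum_diff_head j s g v : j \notin s ->
  boxsum (j :: s) (fun u => g (step u j) + g u) v =
  boxsum s g (upd v j N) + boxsum s g (upd v j 0).
Proof.
move=> js /=; under eq_bigr do rewrite boxsumD boxsum_step //.
have stepE k : step (upd v j k) j = upd v j k.+1.
  by apply: funext => i; rewrite /step /upd; case: eqVneq => //=; rewrite ?addn1 ?addn0.
under eq_bigr do rewrite stepE.
rewrite -(big_mkord xpredT (fun k => boxsum s g (upd v j k.+1) + boxsum s g (upd v j k))).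
rewrite -[X in _ + X](oppr_pchar2 (_ : 2 \in [pchar 'F_2])) ?pchar_Fp //.
rewrite -[RHS](telescope_sumr (fun k => boxsum s g (upd v j k))) //.
by apply: eq_bigr => k _; rewrite oppr_pchar2 ?pchar_Fp.
Qed.

Lemma eq_boxsum s g h v :
  (forall u, (forall i, i \notin s -> u i = v i) -> (forall i, i \in s -> u i < N)%N ->
     g u = h u) -> boxsum s g v = boxsum s h v.
Proof.
elim: s v => [|j s IH] v gh /=; first exact: gh.
apply: eq_bigr => k _; apply: IH => u u1 u2; apply: gh => i; rewrite inE ?negb_or.
  by move=> /andP[ij is_]; rewrite u1 // /upd (negPf ij).
have [is_ _|is_] := boolP (i \in s); first exact: u2.
by rewrite orbF => /eqP ij; rewrite u1 // /upd ij eqxx.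
Qed.

Lemma boxsum0 s v : boxsum s (fun=> 0) v = 0.
Proof. by elim: s v => //= j s IH v; apply: big1 => k _; exact: IH. Qed.

Lemma boxsum_diff0 s g v j : uniq s -> j \in s ->
  (forall u, u j = 0%N \/ u j = N -> g u = 0) ->
  boxsum s (fun u => g (step u j) + g u) v = 0.
Proof.
move=> us js g0; elim: s v us js => // i s IH v /= /andP[+ us]; rewrite inE.
case: (eqVneq j i) => [<- is_ _|ij is_ /= js].
  rewrite -/(boxsum (j :: s) _ v) boxsum_diff_head //.
  have e0 c : c = 0%N \/ c = N -> boxsum s g (upd v j c) = 0.
    move=> c0; rewrite (@eq_boxsum _ _ (fun=> 0)) ?boxsum0 // => u u1 _; apply: g0.
    by rewrite u1 // /upd eqxx.
  by rewrite !e0 ?addr0; auto.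
by apply: big1 => k _; exact: IH.
Qed.

(** No edge with direction in [S] changes coordinate [k], so the factor coming from [A k] compares
    two equal labels and vanishes. *)
Lemma cup_const (A : I -> (I -> nat) -> 'F_2) s S v k : k \in s -> k \notin S ->
  (forall u j, j != k -> u k = v k -> A k (step u j) = A k u) ->
  cup (map A s) S v = 0.
Proof.
move=> + kS; elim: s S v kS => // i s IH S v kS.
have stepk u j : j != k -> step u j k = u k.
  by move=> jk; rewrite /step eq_sym (negPf jk) addn0.
rewrite inE => ks Ak /=; apply: big1 => j jS.
have jk : j != k by apply: contraNneq kS => <-.
case/orP: ks => [/eqP ki|ks]; first by rewrite -ki Ak // F2_addrr mul0r.
rewrite IH ?mulr0 ?inE ?(negPf kS) ?andbF // => u i' ik uk.
by apply: Ak; rewrite // uk stepk.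
Qed.

Lemma sum_neq0 S (F : I -> 'F_2) : \sum_(j in S) F j != 0 -> exists2 j, j \in S & F j != 0.
Proof.
move=> nz; apply: contrapT => h; move/eqP: nz; apply; apply: big1 => j jS.
by apply: contrapT => /eqP nz; apply: h; exists j.
Qed.

(** A nonzero sum has a nonzero term, that is, a monotone edge path with all factors nonzero; [w]
    and [w'] are the ends of the edge belonging to [k]. *)
Lemma cup_witness (A : I -> (I -> nat) -> 'F_2) s S v k : k \in s ->
  cup (map A s) S v != 0 ->
  exists w w', [/\ forall i, (v i <= w i <= v i + (i \in S))%N,
    forall i, (v i <= w' i <= v i + (i \in S))%N & A k w != A k w'].
Proof.
have stepP u T j i : j \in T -> (u i <= step u j i <= u i + (i \in T))%N.
  by move=> jS; rewrite /step leq_addr leq_add2l; case: eqVneq => [->|//]; rewrite jS.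
elim: s S v => // x s IH S v ks /= /sum_neq0[j jS].
rewrite mulf_eq0 negb_or => /andP[nz1 nz2].
move: ks; rewrite inE => /orP[/eqP->|ks].
  exists (step v j), v; split => [i|i|]; first exact: stepP.
    by rewrite leqnn leq_addr.
  by apply: contraNneq nz1 => ->; rewrite F2_addrr.
have widen u : (forall i, step v j i <= u i <= step v j i + (i \in S :\ j))%N ->
    forall i, (v i <= u i <= v i + (i \in S))%N.
  move=> vu i; case/andP: (vu i) => h1 h2; rewrite (leq_trans _ h1) ?leq_addr //=.
  apply: leq_trans h2 _; rewrite /step -addnA leq_add2l !inE.
  by case: eqVneq => [->|_]; rewrite ?jS.
have [w [w' [w1 w1' ww']]] := IH _ _ ks nz2.
by exists w, w'; split => //; exact: widen.
Qed.

(* By Stokes the sum is over the faces of the box; the faces orthogonal to a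
   direction other than the head of [s] contribute nothing, as a later factor is
   constant along them. *)
Lemma boxsum_cup s (A : I -> (I -> nat) -> 'F_2) v : uniq s ->
  (forall j u, u j = 0%N -> A j u = 0) -> (forall j u, u j = N -> A j u = 1) ->
  boxsum s (cup (map A s) [set i in s]) v = 1.
Proof.
move=> us A0 A1; elim: s us v => [|j s IH] us v.
  by rewrite /= (_ : [set i in [::]] = finset.set0) ?eqxx //; apply/finset.setP => i; rewrite !inE.
have /andP[js us'] := us.
pose G k u := A j u * cup (map A s) ([set i in j :: s] :\ k) u.
rewrite (_ : cup _ _ = fun u => \sum_(k in [set i in j :: s]) (G k (step u k) + G k u));
  last by apply: funext => u; rewrite cup_cons.
rewrite boxsum_sum (bigD1 j) ?inE ?eqxx //= [X in _ + X]big1 ?addr0 => [|k]; last first.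
  rewrite !inE => /andP[/orP[/eqP->|ks] kj]; first by rewrite eqxx in kj.
  apply: (@boxsum_diff0 (j :: s) (G k) v k us) => [|u uk]; first by rewrite inE ks orbT.
  rewrite /G (@cup_const _ _ _ _ k) ?mulr0 ?inE ?eqxx // => w i ik wk.
  have sk : step w i k = w k by rewrite /step eq_sym (negPf ik) addn0.
  by case: uk => uk; [rewrite !A0|rewrite !A1]; rewrite ?sk ?wk.
have /= -> := boxsum_diff_head (G j) v js.
rewrite (@eq_boxsum _ (G j) (fun=> 0) (upd v j 0)); last first.
  by move=> u u1 _; rewrite /G A0 ?mul0r // u1 // /upd eqxx.
rewrite boxsum0 addr0 -[RHS](IH us' (upd v j N)); apply: eq_boxsum => u u1 _.
rewrite /G A1 ?mul1r; last by rewrite u1 // /upd eqxx.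
congr cup; apply/finset.setP => i; rewrite !inE.
by have [->|//] := eqVneq i j; rewrite (negPf js).
Qed.

Lemma boxsum_neq0 s g v : boxsum s g v != 0 -> exists2 u,
  (forall i, i \in s -> u i < N)%N & g u != 0.
Proof.
move=> nz; apply: contrapT => h; move/eqP: nz; apply.
rewrite (@eq_boxsum _ _ (fun=> 0)) ?boxsum0 // => u _ u2.
by apply: contrapT => /eqP nz; apply: h; exists u.
Qed.

End GridDegree.

Lemma discrete_miranda (I : finType) (N : nat) (A : I -> pred (I -> nat)) :
  (0 < N)%N ->
  (forall i u, u i = 0%N -> ~~ A i u) -> (forall i u, u i = N -> A i u) ->
  exists2 v : I -> nat, (forall i, v i < N)%N &
    forall i, exists w w', [/\ forall j, (v j <= w j <= (v j).+1)%N,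
      forall j, (v j <= w' j <= (v j).+1)%N, A i w & ~~ A i w'].
Proof.
move=> N0 A0 A1; pose B i u : 'F_2 := (A i u)%:R.
have := @boxsum_cup I N (enum I) B (fun=> 0%N) (enum_uniq I).
move=> h; have {h} : boxsum N (enum I) (cup (map B (enum I)) [set i in enum I]) (fun=> 0%N) != 0.
  by rewrite h ?oner_eq0 // => i u ui; rewrite /B; [rewrite (negPf (A0 _ _ ui))|rewrite A1].
move=> /boxsum_neq0[v vN nz]; exists v => i; first by apply: vN; rewrite mem_enum.
have [w [w' [w1 w1' ww']]] := cup_witness (mem_enum predT i) nz.
have bnd u : (forall j, v j <= u j <= v j + (j \in [set i in enum I]))%N ->
  (forall j, v j <= u j <= (v j).+1)%N.
  by move=> vu j; have := vu j; rewrite inE mem_enum addn1.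
move: ww'; rewrite /B; case Aw: (A i w); case Aw': (A i w'); rewrite ?eqxx // => _.
  by exists w, w'; rewrite Aw Aw'; split => //; exact: bnd.
by exists w', w; rewrite Aw Aw'; split => //; exact: bnd.
Qed.

Local Open Scope classical_set_scope.
Local Open Scope ring_scope.

(** * Invariance of the boundary *)

Lemma within_continuousP (X Y : topologicalType) (A : set X) (f : X -> Y) :
  {within A, continuous f} <-> forall x, A x -> f @ within A (nbhs x) --> f x.
Proof. exact: subspace_continuousP. Qed.

Definition cube (R : realType) n (a : 'rV[R]_n) (s : R) : set 'rV[R]_n :=
  [set x | forall j, a ord0 j <= x ord0 j <= a ord0 j + s].

Lemma compact_cube (R : realType) n (a : 'rV[R]_n) s : compact (cube a s).
Proof.
have := @rV_compact R n (fun j => [set` `[a ord0 j, a ord0 j + s]])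
  (fun j => @segment_compact _ _ _).
by congr compact; apply/seteqP; split => x h j; have /= := h j; rewrite in_itv.
Qed.

Lemma rV_ballE (R : realType) n (x y : 'rV[R]_n) e : 0 < e ->
  (forall j, `|x ord0 j - y ord0 j| < e) -> ball x e y.
Proof. by move=> e0 xy; split => // i j; rewrite ord1; exact: xy. Qed.

(** Without a zero, compactness gives a grid so fine that around each point some component of [F]
    keeps a strict sign at the scale of one cell, whereas [discrete_miranda] gives a cell on which
    every component changes sign weakly. *)
Lemma poincare_miranda (R : realType) n (a : 'rV[R]_n) (s : R)
    (F : 'rV[R]_n -> 'rV[R]_n) : 0 < s -> {within cube a s, continuous F} ->
  (forall x j, cube a s x -> x ord0 j = a ord0 j -> F x ord0 j <= 0) ->
  (forall x j, cube a s x -> x ord0 j = a ord0 j + s -> 0 <= F x ord0 j) ->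
  exists2 x, cube a s x & F x = 0.
Proof.
move=> s0 /within_continuousP Fc F0 F1; apply: contrapT => nz.
pose P (N : nat) (x : 'rV[R]_n) := exists j (b : bool), forall y, cube a s y ->
  (forall i, `|x ord0 i - y ord0 i| <= s / N%:R) -> 0 < (-1) ^+ b * F y ord0 j.
have /compact_near_coveringP covK := @compact_cube R n a s.
have /filter_ex[N [N0 PN]] : \forall N \near \oo, (0 < N)%N /\ cube a s `<=` P N.
  apply: filterI; first by exists 1%N.
  apply: (covK nat \oo P _) => x Kx.
  have [j Fj] : exists j, F x ord0 j != 0.
    apply: contrapT => h; apply: nz; exists x => //; apply/rowP => j; rewrite mxE.
    by apply: contrapT => /eqP Fj; apply: h; exists j.
  pose b := F x ord0 j < 0.
  have Fjc : (fun y => (-1) ^+ b * F y ord0 j) @ within (cube a s) (nbhs x) -->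
      (-1) ^+ b * F x ord0 j.
    apply: cvgM; first exact: cvg_cst.
    exact: (continuous_cvg _ (@coord_continuous _ _ _ _ _ _) (Fc x Kx)).
  have Fpos : 0 < (-1) ^+ b * F x ord0 j.
   by rewrite -normrEsign ?num_real ?normr_gt0.
  have : nbhs x [set y | cube a s y -> 0 < (-1) ^+ b * F y ord0 j].
    exact: (cvgr_gt _ Fjc _ Fpos).
  move=> /nbhs_ballP[e /= e0 eP].
  have e2 : 0 < e / 2 by lra.
  exists (ball x (e / 2), [set N : nat | s / N%:R < e / 2]) => /=.
    split; first exact: nbhsx_ballx.
    have := nbhs_infty_gtr (s / (e / 2)); apply: filterS => N sN /=.
    have N0 : 0 < N%:R :> R by apply: le_lt_trans sN; rewrite divr_ge0 ?ltW.
    by rewrite ltr_pdivrMr // mulrC -ltr_pdivrMr.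
  move=> [x' N] /= [[_ xx'] sN]; exists j, b => y Ky x'y; apply: eP => //.
  apply: rV_ballE => // i; have := xx' ord0 i; rewrite /ball /= => h.
  by have := le_lt_trans (x'y i) sN; move: h; rewrite !ltr_norml; lra.
pose pt (u : 'I_n -> nat) : 'rV[R]_n := \row_j (a ord0 j + s * (u j)%:R / N%:R).
(* Labels on the two extreme faces are imposed, as [F] may vanish there; [F0] and [F1] keep them
   compatible with the weak sign of [F]. *)
pose A i u := (u i == N) || (u i != 0%N) && (0 < F (pt u) ord0 i).
have NR : 0 < N%:R :> R by rewrite ltr0n.
have [||v vN sgn] := @discrete_miranda 'I_n N A N0.
- by move=> i u ui; rewrite /A ui eqxx /= orbF eq_sym -lt0n.
- by move=> i u ui; rewrite /A ui eqxx.
have Kpt u : (forall j, u j <= N)%N -> cube a s (pt u).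
  move=> uN j; rewrite mxE lerDl mulr_ge0 ?invr_ge0 ?ler0n ?mulr_ge0 ?(ltW s0) //=.
  by rewrite lerD2l ler_pdivrMr // ler_pM2l // ler_nat.
have Kv : cube a s (pt v) by apply: Kpt => j; exact: ltnW.
have [j [b Pb]] := PN _ Kv.
have [w [w' [vw vw' Aw Aw']]] := sgn j.
have wN u : (forall j, v j <= u j <= (v j).+1)%N -> (forall j, u j <= N)%N.
  by move=> vu k; have /andP[_ /leq_trans] := vu k; apply.
have close u : (forall j, v j <= u j <= (v j).+1)%N ->
    forall i, `|pt v ord0 i - pt u ord0 i| <= s / N%:R.
  move=> vu i; have /andP[h1 h2] := vu i.
  rewrite !mxE opprD addrACA subrr add0r -mulrBl -mulrBr normrM normrM.
  rewrite (gtr0_norm s0) [`|_^-1|]ger0_norm ?invr_ge0 ?ler0n // ler_pM2r ?invr_gt0 //.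
  rewrite ler_piMr ?(ltW s0) // ler_norml.
  move: h1 h2; rewrite -!(ler_nat R) -natr1; lra.
have := Pb _ (Kpt _ (wN _ vw)) (close _ vw).
have := Pb _ (Kpt _ (wN _ vw')) (close _ vw').
have Fw : 0 <= F (pt w) ord0 j.
  move: Aw => /orP[/eqP wj|/andP[_ /ltW//]].
  by apply: F1; [exact/Kpt/wN|rewrite mxE wj mulfK ?gt_eqF].
have Fw' : F (pt w') ord0 j <= 0.
  move: Aw'; rewrite negb_or negb_and negbK -leNgt => /andP[_ /orP[/eqP wj|//]].
  by apply: F0; [exact/Kpt/wN|rewrite mxE wj mulr0 mul0r addr0].
by case: b {Pb} => /=; rewrite ?expr1 ?expr0; lra.
Qed.

(** Charts are continuous only within their domains; this composes them with maps that lie in the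
    domain eventually along a filter. *)
Lemma cvg_within_comp (X : Type) (Y Z : topologicalType) (F : set_system X) (B : set Y)
    (f : X -> Y) (g : Y -> Z) (y : Y) : Filter F ->
  {within B, continuous g} -> B y -> f @ F --> y -> (\forall x \near F, B (f x)) ->
  g (f x) @[x --> F] --> g y.
Proof.
move=> FF /within_continuousP gc By fy FB A /(gc y By) /= gA.
have {}fy : F [set x | B (f x) -> A (g (f x))] := fy _ gA.
have {}FB : F [set x | B (f x)] := FB.
change (F [set x | A (g (f x))]).
by apply: filterS2 fy FB => x /= h /h.
Qed.

Lemma half_spaceS (R : realType) n (v : 'rV[R]_n.+1) :
  half_space R n.+1 v <-> 0 <= v ord0 ord0.
Proof. by split=> [/(_ ord0)->//|v0 j j0]; rewrite (_ : j = ord0) //; apply/val_inj. Qed.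

Lemma half_space_boundaryS (R : realType) n (v : 'rV[R]_n.+1) :
  half_space_boundary R n.+1 v <-> v ord0 ord0 = 0.
Proof.
split=> [[j [j0]]|v0]; last by exists ord0.
by rewrite (_ : j = ord0) //; apply/val_inj.
Qed.

Lemma open_coord_gt0 (R : realType) n i : open [set v : 'rV[R]_n | 0 < v ord0 i].
Proof.
have /continuousP/(_ _ (@open_gt R 0)) := @coord_continuous R 1 n ord0 i; exact.
Qed.

(* Otherwise [Phi eps] is close to the identity on [K] yet never takes the value
   [p], because the height of [g] at [y] is 0. *)
Lemma chart_boundary_transfer (R : realType) n (T : topologicalType) (U U' : set T)
    (f g : T -> 'rV[R]_n) y :
  half_space_chart U f -> half_space_chart U' g -> U y -> U' y ->
  half_space_boundary R n (g y) -> half_space_boundary R n (f y).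
Proof.
case: n f g => [f g _ _ _ _ [[] ] //|n f g].
move=> [oU [ O oO [f' [fO f'U fc f'c]]]] [oU' [ O' oO' [g' [gO g'U gc g'c]]]] Uy U'y.
move=> /half_space_boundaryS gy0; apply/half_space_boundaryS/eqP/negPn/negP => fy0.
set p := f y; have [[ Op /half_spaceS p0] f'p] := fO _ Uy.
have {fy0} p_gt0 : 0 < p ord0 ord0 by rewrite lt_def p0 andbT.
pose e0 : 'rV[R]_n.+1 := delta_mx ord0 ord0.
pose W := O `&` [set v : 'rV[R]_n.+1 | 0 < v ord0 ord0].
have oW : open W by apply: openI => //; exact: open_coord_gt0.
have WOH : W `<=` O `&` half_space R n.+1.
  by move=> x [ Ox x0]; split => //; apply/half_spaceS/ltW.
have f'cW x : W x -> f' @ x --> f' x.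
  move=> Wx; apply: (@cvg_within_comp _ _ _ (nbhs x) _ id f' x _ f'c (WOH _ Wx)) => //.
  by apply: filterS WOH _; exact: open_nbhs_nbhs.
(* [V] is the part of the interior of the first chart where the change to the second chart is
   defined. *)
pose V := [set x | W x /\ U' (f' x)].
have Vnbhs x : V x -> nbhs x V.
  move=> [Wx U'x]; apply: filterI; first exact: open_nbhs_nbhs.
  by apply: (f'cW _ Wx); exact: open_nbhs_nbhs.
have Vp : V p by split => //; rewrite /= f'p.
have [r r0 KV] : exists2 r, 0 < r & cube (p - const_mx r) (r *+ 2) `<=` V.
  have /nbhs_ballP[e /= e_gt0 eV] := Vnbhs _ Vp.
  exists (e / 2) => [|x Kx]; first lra.
  apply: eV; apply: rV_ballE => // j; have := Kx j; rewrite !mxE ltr_norml; lra.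
set K := cube _ _ in KV.
(* [sh] raises the height in the second chart by [eps], and [Phi] reads the result in the first
   chart. *)
pose sh eps x := g (f' x) + eps *: e0.
pose Phi eps x := f (g' (sh eps x)).
pose P eps x := [/\ (O' `&` half_space R n.+1) (sh eps x), U (g' (sh eps x)) &
  forall j, `|Phi eps x ord0 j - x ord0 j| <= r].
have shE eps x : sh eps x ord0 ord0 = g (f' x) ord0 ord0 + eps by rewrite !mxE eqxx mulr1.
have shc (J : Type) (G : set_system J) (u : J -> 'rV[R]_n.+1) (w : J -> R) x eps :
    Filter G -> V x -> u @ G --> x -> w @ G --> eps -> sh (w z) (u z) @[z --> G] --> sh eps x.
  move=> FG [Wx U'x] ux we; apply: cvgD; last first.
    by apply: cvgZ => //; exact: cvg_cst.
  have f'u : f' (u z) @[z --> G] --> f' x by exact: cvg_comp ux (f'cW _ Wx).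
  apply: (@cvg_within_comp J _ _ G U' (fun z => f' (u z)) g _ FG gc U'x f'u).
  by apply: f'u; exact: open_nbhs_nbhs.
(* The general filter serves twice: with [eps] tending to 0 together with a moving point, and with
   [eps] fixed. *)
have Phic (J : Type) (G : set_system J) (u : J -> 'rV[R]_n.+1) (w : J -> R) x eps :
    Filter G -> V x -> u @ G --> x -> w @ G --> eps ->
    (O' `&` half_space R n.+1) (sh eps x) -> U (g' (sh eps x)) ->
    (\forall z \near G, (O' `&` half_space R n.+1) (sh (w z) (u z))) ->
    (\forall z \near G, U (g' (sh (w z) (u z)))) /\ Phi (w z) (u z) @[z --> G] --> Phi eps x.
  move=> FG Vx ux we OHsh Ush nearOH.
  have g'u : g' (sh (w z) (u z)) @[z --> G] --> g' (sh eps x).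
    exact: (@cvg_within_comp J _ _ G _ (fun z => sh (w z) (u z)) g' _
      FG g'c OHsh (shc _ _ _ _ _ _ FG Vx ux we) nearOH).
  have nU : \forall z \near G, U (g' (sh (w z) (u z))).
    by apply: g'u; exact: open_nbhs_nbhs.
  split=> //; exact: (@cvg_within_comp J _ _ G _ (fun z => g' (sh (w z) (u z))) f _
    FG fc Ush g'u nU).
have /compact_near_coveringP covK : compact K by exact: compact_cube.
have /filter_ex[eps [eps0 PK]] : \forall eps \near (0 : R)^'+, 0 < eps /\ K `<=` P eps.
  apply: filterI; first exact: nbhs_right_gt.
  apply: (covK R (0 : R)^'+ P _) => x /KV Vx; have [Wx U'x] := Vx.
  have [ Ox x0] := Wx; have [Ufx ff'x] := f'U _ (WOH _ Wx).
  set G := filter_prod (nbhs x) (0 : R)^'+.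
  have ux : (fun z : 'rV[R]_n.+1 * R => z.1) @ G --> x by exact: cvg_fst.
  have we : (fun z : 'rV[R]_n.+1 * R => z.2) @ G --> (0 : R).
    apply: cvg_trans (@cvg_snd _ _ _ _ _) _; exact: cvg_within.
  have sh0 : sh 0 x = g (f' x) by rewrite /sh scale0r addr0.
  have [[ O'q Hq] g'q] := gO _ U'x.
  have nearOH : \forall z \near G, (O' `&` half_space R n.+1) (sh z.2 z.1).
    apply: filterI.
      by apply: (shc _ _ _ _ _ _ _ Vx ux we); rewrite sh0; exact: open_nbhs_nbhs.
    exists (V, [set e | 0 < e]) => /=.
      by split; [exact: Vnbhs|exact: nbhs_right_gt].
    move=> [z e] /= [Vz e_gt0]; apply/half_spaceS; rewrite shE.
    by have [[_ /half_spaceS]] := gO _ Vz.2; lra.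
  have := Phic _ _ _ _ _ _ _ Vx ux we; rewrite sh0 g'q /Phi sh0 g'q ff'x.
  move=> /(_ _ (conj O'q Hq) Ufx nearOH)[nU Phix].
  have r2 : 0 < r / 2 by lra.
  have nPhi : \forall z \near G, ball x (r / 2) (Phi z.2 z.1).
    by apply: Phix; exact: nbhsx_ballx.
  have nx : \forall z \near G, ball x (r / 2) z.1 by apply: ux; exact: nbhsx_ballx.
  refine (filterS _ (filterI nearOH (filterI nU (filterI nPhi nx)))).
  move=> [z e] /= [ OHz [Uz [[_ Phiz] [_ xz]]]]; split => // j.
  have := Phiz ord0 j; have := xz ord0 j; rewrite /ball /= !ltr_norml ler_norml; lra.
(* A displacement of at most [r] cannot carry a face at distance [r] from [p] across [p], whence the
   sign conditions. *)
have [||||x Kx] := @poincare_miranda R _ (p - const_mx r) (r *+ 2) (fun x => Phi eps x - p).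
- by lra.
- apply/within_continuousP => x Kx; apply: cvgB; last exact: cvg_cst.
  have [ OHx Ux _] := PK _ Kx.
  have nearOH : \forall z \near within K (nbhs x), (O' `&` half_space R n.+1) (sh eps z).
    by change (nbhs x [set z | K z -> (O' `&` half_space R n.+1) (sh eps z)]);
      apply: filterE => z /PK[].
  have ux : z @[z --> within K (nbhs x)] --> x by exact: cvg_within.
  exact: (Phic _ _ _ _ _ _ _ (KV _ Kx) ux (@cvg_cst _ eps _ _ _) OHx Ux nearOH).2.
- move=> x j Kx; have [_ _ /(_ j)] := PK _ Kx; rewrite !mxE ler_norml; lra.
- move=> x j Kx; have [_ _ /(_ j)] := PK _ Kx; rewrite !mxE ler_norml; lra.
move=> /eqP; rewrite subr_eq0 => /eqP Phix.
have [ Osh Ush _] := PK _ Kx; have [Wx U'x] := KV _ Kx.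
have [_ gg'] := g'U _ Osh.
(* [f] is injective on [U], so the pushed point is [y]; yet its height in the second chart is at
   least [eps]. *)
have zy : g' (sh eps x) = y.
  by rewrite -(fO _ Ush).2 -[RHS](fO _ Uy).2 -/(Phi eps x) Phix.
move: gy0; rewrite -zy gg' shE.
have [[_ /half_spaceS]] := gO _ U'x; lra.
Qed.

(** * The cone on a triangulated sphere *)

Lemma cvg_initial (J : Type) (W : choiceType) (T : topologicalType) (f : W -> T)
    (G : set_system J) (u : J -> initial_topology f) (w : initial_topology f) : Filter G ->
  f (u z) @[z --> G] --> f w -> u @ G --> w.
Proof.
move=> FG fu A [B [[V oV <-] Vw VA]].
have : G [set z | V (f (u z))] by exact: (fu _ (open_nbhs_nbhs (conj oV Vw))).
exact: (@filterS _ G FG _ (u @^-1` A) (fun z Vz => VA _ Vz)).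
Qed.

Lemma cvg_prod_topology (J : Type) (I : Type) (K : I -> topologicalType)
    (G : set_system J) (u : J -> prod_topology K) (f : prod_topology K) : Filter G ->
  (forall i, u z i @[z --> G] --> f i) -> u @ G --> f.
Proof. by move=> FG uf; apply/cvg_sup => i; apply: cvg_initial; exact: uf. Qed.

Lemma cvg_proj (J : Type) (I : eqType) (K : I -> topologicalType)
    (G : set_system J) (u : J -> prod_topology K) (f : prod_topology K) i : Filter G ->
  u @ G --> f -> u z i @[z --> G] --> f i.
Proof. by move=> FG uf; exact: (cvg_comp _ _ uf (@proj_continuous I K i f)). Qed.

Lemma cvg_coord (R : realType) (J : Type) n (G : set_system J)
    (u : J -> 'rV[R]_n) (v : 'rV[R]_n) j : Filter G ->
  u @ G --> v -> u z ord0 j @[z --> G] --> v ord0 j.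
Proof. by move=> FG uv; exact: (cvg_comp _ _ uv (@coord_continuous _ _ _ _ _ _)). Qed.

Lemma cvg_set_type (J : Type) (T : topologicalType) (Z : set T)
    (G : set_system J) (u : J -> Z) (z0 : Z) : Filter G ->
  set_val (u z) @[z --> G] --> set_val z0 -> u @ G --> z0.
Proof. by move=> FG; exact: cvg_initial. Qed.

Lemma set_val_continuous (T : topologicalType) (Z : set T) : continuous (@set_val T Z).
Proof. exact: initial_continuous. Qed.

Lemma cvg_rV (J : Type) (T : topologicalType) n (G : set_system J)
    (u : J -> 'rV[T]_n) (v : 'rV[T]_n) : Filter G ->
  (forall j, u z ord0 j @[z --> G] --> v ord0 j) -> u @ G --> v.
Proof.
move=> FG uv A [P vP PA].
have : G [set z | forall j, P ord0 j (u z ord0 j)].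
  apply: (@filter_forall _ _ (fun j z => P ord0 j (u z ord0 j)) G FG) => j.
  exact: (uv _ _ (vP ord0 j)).
by apply: (@filterS _ G FG _ (u @^-1` A)) => z Pz; apply: PA => i j; rewrite ord1.
Qed.


(** * Radial coordinates on the cone and on Euclidean space *)

Section Cone.
Variables (R : realType) (I : finType).

(** Without the normalization of the sum, |L| becomes its open cone, with apex 0. *)
Definition cone (L : {set {set I}}) : set {ptws I -> R} :=
  [set t | (forall i, 0 <= t i) /\ finset (fun i => t i != 0) \in L].

Lemma cvg_coord_sum (J : Type) (G : set_system J) (u : J -> {ptws I -> R}) (t : {ptws I -> R}) :
  Filter G -> u @ G --> t -> \sum_i u z i @[z --> G] --> \sum_i t i.
Proof.
move=> FG ut; apply: (@cvg_big _ _ _ _ _ (@add_continuous R) _ G _ (fun i z => u z i) t) => i _.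
exact: cvg_proj.
Qed.

Definition norm2 n (v : 'rV[R]_n) : R := Num.sqrt (\sum_j v ord0 j ^+ 2).

Lemma cvg_norm2 (J : Type) n (G : set_system J) (u : J -> 'rV[R]_n) (v : 'rV[R]_n) :
  Filter G -> u @ G --> v -> norm2 (u z) @[z --> G] --> norm2 v.
Proof.
move=> FG uv; apply: (continuous_cvg _ (@sqrt_continuous R _)).
apply: (@cvg_big _ _ _ _ _ (@add_continuous R) _ G _ (fun j z => u z ord0 j ^+ 2)
  (fun j => v ord0 j ^+ 2)) => j _.
by apply: cvgM; exact: cvg_coord.
Qed.

Lemma norm2_ge0 n (v : 'rV[R]_n) : 0 <= norm2 v.
Proof. exact: sqrtr_ge0. Qed.

Lemma norm2Z n a (v : 'rV[R]_n) : 0 <= a -> norm2 (a *: v) = a * norm2 v.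
Proof.
move=> a0; rewrite /norm2 (eq_bigr (fun j => a ^+ 2 * v ord0 j ^+ 2)) => [|j _].
  by rewrite -mulr_sumr sqrtrM ?sqr_ge0 // sqrtr_sqr ger0_norm.
by rewrite mxE exprMn.
Qed.

Lemma norm2_eq0 n (v : 'rV[R]_n) : (norm2 v == 0) = (v == 0).
Proof.
apply/idP/eqP => [|->]; last first.
  by rewrite /norm2 big1 ?sqrtr0 // => j _; rewrite mxE expr0n.
rewrite sqrtr_eq0 => v0; have : \sum_j v ord0 j ^+ 2 == 0.
  by rewrite eq_le v0 sumr_ge0 // => j _; exact: sqr_ge0.
rewrite psumr_eq0 => [/allP vj|j _]; last exact: sqr_ge0.
apply/rowP => j; rewrite mxE; apply/eqP; rewrite -sqrf_eq0.
by have /implyP := vj j (mem_index_enum _); apply.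
Qed.

Lemma coord_le_norm2 n (v : 'rV[R]_n) j : `|v ord0 j| <= norm2 v.
Proof.
rewrite -sqrtr_sqr ler_sqrt ?sumr_ge0 // => [|k _]; last exact: sqr_ge0.
by rewrite (bigD1 j) //= lerDl sumr_ge0 // => k _; exact: sqr_ge0.
Qed.

Lemma norm2_sphere n (v : 'rV[R]_n) : euclidean_sphere R n v <-> norm2 v = 1.
Proof.
split=> [v1|/(congr1 (fun x => x ^+ 2))]; first by rewrite /norm2 v1 sqrtr1.
rewrite /euclidean_sphere /= sqr_sqrtr ?expr1n // sumr_ge0 // => j _.
exact: sqr_ge0.
Qed.

Lemma cone_support (t : I -> R) c : c != 0 ->
  finset (fun i => c * t i != 0) = finset (fun i => t i != 0).
Proof. by move=> c0; apply/setP => i; rewrite !inE mulf_eq0 negb_or c0. Qed.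

(* Radial extension of the given homeomorphism. *)
Lemma cone_homeomorphic (L : {set {set I}}) n : finset.set0 \in L ->
  homeomorphic (geometric_realization R L) (euclidean_sphere R n) ->
  homeomorphic (cone L) [set: 'rV[R]_n].
Proof.
move=> L0 [h [k [hS kL hc kc]]].
(* [s] is the radius on the cone and corresponds to [norm2] on the Euclidean side. At the apex and
   at the origin the zero factor absorbs the meaningless value of [h] or [k]. *)
pose s (t : {ptws I -> R}) := \sum_i t i.
pose nu (t : {ptws I -> R}) : {ptws I -> R} := fun i => (s t)^-1 * t i.
pose kappa (t : {ptws I -> R}) : 'rV[R]_n := s t *: h (nu t).
pose lam (w : 'rV[R]_n) : {ptws I -> R} := fun i => norm2 w * k ((norm2 w)^-1 *: w) i.
have s_ge0 t : cone L t -> 0 <= s t by move=> [t0 _]; exact: sumr_ge0.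
have s_eq0 t : cone L t -> s t = 0 -> t = fun=> 0.
  move=> [t0 _] /eqP; rewrite /s psumr_eq0 => [/allP ti|//].
  by apply/funext => i; apply/eqP; exact: (ti i (mem_index_enum _)).
have normalized t : cone L t -> s t != 0 -> geometric_realization R L (nu t).
  move=> Ct s0; have [t0 tL] := Ct; split=> [i||].
  - by rewrite mulr_ge0 ?invr_ge0 ?s_ge0.
  - by rewrite -mulr_sumr mulVf.
  - by rewrite cone_support // invr_eq0.
have unit w : w != 0 -> euclidean_sphere R n ((norm2 w)^-1 *: w).
  move=> w0; apply/norm2_sphere; rewrite norm2Z ?invr_ge0 ?norm2_ge0 // mulVf //.
  by rewrite norm2_eq0.
have s_lam w : w != 0 -> s (lam w) = norm2 w.
  by move=> /unit/kL[[_ k1 _] _]; rewrite /s -mulr_sumr k1 mulr1.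
have lam0 : lam 0 = fun=> 0.
  apply/funext => i; rewrite /lam.
  by have /eqP -> : norm2 (0 : 'rV[R]_n) == 0; rewrite ?norm2_eq0 // mul0r.
have s0 : s (fun=> 0) = 0 by rewrite /s big1.
have kappa0 : kappa (fun=> 0) = 0 by rewrite /kappa s0 scale0r.
have norm_kappa t : cone L t -> s t != 0 -> norm2 (kappa t) = s t.
  move=> Ct st; rewrite norm2Z ?s_ge0 //.
  by have /hS[/norm2_sphere-> _] := normalized _ Ct st; rewrite mulr1.
exists kappa, lam; split => [t Ct|w _||].
- split=> //; have [st|st] := eqVneq (s t) 0.
    by rewrite (s_eq0 _ Ct st) kappa0 lam0.
  apply/funext => i; rewrite /lam norm_kappa // /kappa scalerA mulVf // scale1r.
  by have [_ ->] := hS _ (normalized _ Ct st); rewrite /nu mulVKf.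
- have [->|w0] := eqVneq w 0.
    rewrite lam0; split => //; split => //.
    by rewrite (_ : finset _ = finset.set0) //; apply/setP => i; rewrite !inE eqxx.
  have nw : norm2 w != 0 by rewrite norm2_eq0.
  have [[k0 k1 kL'] hk] := kL _ (unit _ w0); split.
    split=> [i|]; first by rewrite mulr_ge0 ?norm2_ge0.
    by rewrite cone_support.
  rewrite /kappa s_lam // (_ : nu (lam w) = k ((norm2 w)^-1 *: w)).
    by rewrite hk scalerA mulfV // scale1r.
  by apply/funext => i; rewrite /nu s_lam // /lam mulKf.
- apply/within_continuousP => t Ct; set G := within _ _.
  have Gt : u @[u --> G] --> t by exact: cvg_within.
  have sG : s u @[u --> G] --> s t by exact: cvg_coord_sum.
  have GC : \forall u \near G, cone L u by exact: withinT.
  (* At the apex, continuity comes from a bound: each coordinate of [kappa u] is at most its norm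
     [s u], which tends to 0. *)
  have [st|st] := eqVneq (s t) 0.
    rewrite (s_eq0 _ Ct st) kappa0; apply: cvg_rV => j; rewrite mxE.
    apply/cvgr0Pnorm_lt => e e0; move: sG; rewrite st => /cvgr_lt/(_ _ e0) se.
    apply: filterS2 GC se => u Cu; apply: le_lt_trans.
    have [su|su] := eqVneq (s u) 0; first by rewrite (s_eq0 _ Cu su) kappa0 mxE normr0 s0.
    by rewrite -norm_kappa //; exact: coord_le_norm2.
  have nzG : \forall u \near G, s u != 0 by exact: (cvgr_neq0 _ sG st).
  apply: cvgZ => //.
  have nuG : nu u @[u --> G] --> nu t.
    by apply: cvg_prod_topology => i; apply: cvgM; [exact: cvgV|];
      exact: (@cvg_proj _ I (fun=> R) G id t i).
  have nGL : \forall u \near G, geometric_realization R L (nu u).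
    by apply: filterS2 GC nzG => u; exact: normalized.
  exact: (@cvg_within_comp _ _ _ G _ nu h _ _ hc (normalized _ Ct st) nuG nGL).
- apply/within_continuousP => w _; set G := within _ _.
  have Gw : u @[u --> G] --> w by exact: cvg_within.
  have nG : norm2 u @[u --> G] --> norm2 w by exact: cvg_norm2.
  apply: cvg_prod_topology => i.
  (* At the origin, barycentric coordinates being at most 1, [lam u i] is bounded by [norm2 u]. *)
  have [w0|w0] := eqVneq w 0.
    rewrite w0 lam0; apply/cvgr0Pnorm_lt => e e0.
    have : norm2 w = 0 by apply/eqP; rewrite norm2_eq0 w0.
    move: nG => /[swap] -> /cvgr_lt/(_ _ e0); apply: filterS => u; apply: le_lt_trans.
    have [->|u0] := eqVneq u 0; first by rewrite lam0 normr0 norm2_ge0.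
    rewrite /lam normrM ger0_norm ?norm2_ge0 // ler_piMr ?norm2_ge0 //.
    have [[k0 k1 _] _] := kL _ (unit _ u0).
    by rewrite ger0_norm // -k1 (bigD1 i) //= lerDl sumr_ge0.
  have nw : norm2 w != 0 by rewrite norm2_eq0.
  apply: cvgM => //.
  have kw : k ((norm2 u)^-1 *: u) @[u --> G] --> k ((norm2 w)^-1 *: w).
    have unitG : (norm2 u)^-1 *: u @[u --> G] --> (norm2 w)^-1 *: w.
      by apply: cvgZ => //; exact: cvgV.
    have nGS : \forall u \near G, euclidean_sphere R n ((norm2 u)^-1 *: u).
      have nzG : \forall u \near G, norm2 u != 0 by exact: (cvgr_neq0 _ nG nw).
      by apply: filterS nzG => u nu0; apply: unit; rewrite -norm2_eq0.
    exact: (@cvg_within_comp _ _ _ G _ _ k _ _ kc (unit _ w0) unitG nGS).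
  exact: (@cvg_proj _ I (fun=> R) G (fun u => k ((norm2 u)^-1 *: u)) _ i _ kw).
Qed.
End Cone.

(** * Charts of the polyhedral product *)

Lemma hausdorff_set_type (T : topologicalType) (Z : set T) :
  hausdorff_space T -> hausdorff_space Z.
Proof.
move=> hT p q pq; apply: val_inj; apply: hT => A B Ap Bq.
have [z [Az Bz]] := pq _ _ (set_val_continuous Ap) (set_val_continuous Bq).
by exists (set_val z).
Qed.

(** A filter pushed to the ambient space clusters at a point of [Z]; open sets of [Z] being traces,
    it clusters there in [Z] as well. *)
Lemma compact_set_type (T : topologicalType) (Z : set T) : compact Z -> compact [set: Z].
Proof.
move=> cZ F FF _.
have FZ : (set_val @ F) Z.
  have : F [set z | Z (set_val z)] by apply: filterE => z; exact: set_mem (valP z).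
  by [].
have [x [Zx xF]] := cZ _ _ FZ.
exists (SigSub (mem_set Zx)); split=> // A C FA [_ [[V oV <-] Vx VC]].
have FA' : (set_val @ F) (set_val @` A).
  by apply: (@filterS _ F _ A) FA => z Az; exists z.
have [_ [[z Az <-] Vz]] := xF _ _ FA' (open_nbhs_nbhs (conj oV Vx)).
by exists z; split=> //; exact: VC.
Qed.

Lemma second_countable_set_type (T : topologicalType) (Z : set T) :
  @second_countable T -> @second_countable Z.
Proof.
move=> [B cB [oB bB]]; exists [set (@set_val T Z) @^-1` U | U in B].
  exact: card_le_trans (card_image_le _ _) cB.
split=> [_ [U BU <-]|z A [_ [[V oV <-] Vz VA]]].
  by apply: open_comp (oB _ BU) => x _; exact: set_val_continuous.
have [U [BU Uz] UV] := bB _ _ (open_nbhs_nbhs (conj oV Vz)).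
by exists (set_val @^-1` U) => [|y /UV/VA//]; split=> //; exists U.
Qed.

(** Finiteness of [I] makes the boxes of basic open sets both open and countable in number. *)
Lemma second_countable_prod (I : finType) (K : I -> topologicalType) :
  (forall i, @second_countable (K i)) -> @second_countable (prod_topology K).
Proof.
move=> K2.
have enum i : exists e : nat -> set (K i), (forall k, open (e k)) /\
    forall (x : K i) A, nbhs x A -> exists k, e k x /\ e k `<=` A.
  have [B /countable_injP[c ci] [oB bB]] := K2 i.
  (* Indices that name no basic set fall back on [setT], which is open. *)
  exists (fun k => xget setT [set U | B U /\ c U = k]); split=> [k|x A /bB].
    by case: xgetP => [_ -> [/oB]//|_]; exact: openT.
  move=> [U [BU Ux] UA]; exists (c U).
  case: xgetP => [V -> [BV cV]|/(_ U)]; last by case.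
  by rewrite (ci _ _ _ _ cV) ?inE.
pose e i := projT1 (cid (enum i)).
have oe i k : open (e i k) by rewrite /e; case: cid => ? [].
have be i (x : K i) A : nbhs x A -> exists k, e i k x /\ e i k `<=` A.
  by rewrite /e; case: cid => ? /= [_]; apply.
pose box (c : {ffun I -> nat}) : set (prod_topology K) := [set x | forall i, e i (c i) (x i)].
have boxP (x : prod_topology K) (P : forall i, set (K i)) : (forall i, nbhs (x i) (P i)) ->
    exists c, box c x /\ forall y, box c y -> forall i, P i (y i).
  move=> xP; have ex i := cid (be i _ _ (xP i)).
  exists [ffun i => projT1 (ex i)]; split=> [i|y xy i].
    by rewrite ffunE; case: (ex i) => ? [].
  by have := xy i; rewrite ffunE; case: (ex i) => /= k [_]; apply.
have nbox c x : box c x -> nbhs x (box c).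
  move=> cx; apply: (@filter_forall _ _ (fun i => [set y : prod_topology K | e i (c i) (y i)])
    (nbhs x)).
  move=> i; apply: (@cvg_proj _ _ K (nbhs x) id x i) => //; apply: open_nbhs_nbhs.
  by split=> //; exact: cx.
exists (range box); first exact: card_le_trans (card_image_le _ _) (countableP _).
split=> [_ [c _ <-]|x]; first by rewrite openE => x; exact: nbox.
(* The boxes around [x] generate a filter; its convergence to [x], checked coordinatewise, says that
   they form a neighbourhood base. *)
have FF : Filter (filter_from [set U | range box U /\ U x] id).
  apply: filter_from_filter.
    have [c [cx _]] := boxP x (fun=> setT) (fun=> filterT).
    by exists (box c); split=> //; exists c.
  move=> _ _ [[c _ <-] cx] [[c' _ <-] c'x].
  have [|k [kx ky]] := boxP x (fun i => e i (c i) `&` e i (c' i)).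
    by move=> i; apply: filterI; apply: open_nbhs_nbhs.
  exists (box k); first by split=> //; exists k.
  by move=> y /ky yk; split=> i; have [] := yk i.
apply: (@cvg_prod_topology _ _ K _ id x FF).
move=> i A xA.
(* Only coordinate [i] is constrained; [ecast] transports [y] from [K j] to [K i]. *)
have [|k [kx ky]] := boxP x (fun j => [set y | forall ij : j = i, A (ecast l (K l) ij y)]).
  move=> j; case: (eqVneq j i) => [->|ji].
    apply: filterS xA => y Ay ij; by rewrite (eq_irrelevance ij erefl).
  by apply: filterE => y ij; rewrite ij eqxx in ji.
exists (box k); first by split=> //; exists k.
by move=> y /ky/(_ i erefl).
Qed.

(** The boundary is defined by the existence of a chart; invariance lets any chart at [x] decide. *)
Lemma manifold_boundaryP (R : realType) n (T : topologicalType) (U : set T)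
    (f : T -> 'rV[R]_n) x : half_space_chart U f -> U x ->
  manifold_boundary R n T x <-> half_space_boundary R n (f x).
Proof.
move=> fU Ux; split=> [[V [g [Vx gV gx]]]|fx]; last by exists U, f.
exact: (chart_boundary_transfer fU gV Ux Vx gx).
Qed.

Lemma closed_manifold_boundary (R : realType) n (T : topologicalType) :
  manifold_with_boundary R n.+1 T -> closed (manifold_boundary R n.+1 T).
Proof.
move=> [_ _ Tch]; rewrite -[X in closed X]setCK; apply: open_closedC.
rewrite openE => x xB; have [U [f [Ux fU]]] := Tch x.
have [oU [ O oO [g [fO _ fc _]]]] := fU.
have fx0 : 0 < f x ord0 ord0.
  rewrite lt_def; have [[_ /half_spaceS->] _] := fO _ Ux; rewrite andbT.
  by apply/eqP => fx; apply/xB/(manifold_boundaryP fU Ux)/half_space_boundaryS.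
have xU : within U (nbhs x) = nbhs x.
  by apply: within_interior; apply: open_nbhs_nbhs.
move/within_continuousP/(_ x Ux) : fc; rewrite xU => /(@cvg_coord _ _ _ _ _ _ ord0 _) fc.
have fpos : nbhs x [set y | 0 < f y ord0 ord0] by exact: (cvgr_gt _ fc _ fx0).
have Unbhs : nbhs x U by exact: open_nbhs_nbhs.
change (nbhs x (~` manifold_boundary R n.+1 T)).
apply: filterS2 Unbhs fpos => y Uy /= fy0 /(manifold_boundaryP fU Uy)/half_space_boundaryS fy.
by rewrite fy ltxx in fy0.
Qed.

(** Coordinates outside a closed [B i] stay outside under small changes, so near [x] supports
    contain [Supp B x]; as [L] is closed under faces, the complement is open. *)
Lemma closed_polyhedral_product (I : finType) (L : {set {set I}})
    (A : I -> topologicalType) (B : forall i, set (A i)) :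
  simplicial_complex L -> (forall i, closed (B i)) -> closed (polyhedral_product L B).
Proof.
move=> [_ Ldown _] Bc; rewrite -[X in closed X]setCK; apply: open_closedC.
rewrite openE => x xL.
have near_notin i : nbhs x [set y : prod_topology A | i \in Supp B x -> y i \notin B i].
  have [iS|iS] := boolP (i \in Supp B x); last by apply: filterE.
  have : nbhs (x i) (~` B i).
    apply: open_nbhs_nbhs; split; first exact: closed_openC.
    by move: iS; rewrite finset.in_set notin_setE.
  move=> /(@cvg_proj _ _ A (nbhs x) id x i _ cvg_id) xB.
  have {}xB : nbhs x [set y : prod_topology A | ~ B i (y i)] by exact: xB.
  by apply: filterS xB => y /= yB _; rewrite notin_setE.
have {}near_notin : nbhs x [set y : prod_topology A | forall i, i \in Supp B x -> y i \notin B i].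
  exact: (@filter_forall _ _ _ (nbhs x) _ near_notin).
change (nbhs x (~` polyhedral_product L B)).
apply: filterS near_notin => y /= yS yL; apply: xL; apply: Ldown yL _.
by apply/fintype.subsetP => i /yS yi; rewrite finset.in_set.
Qed.

(** * The chart around one point of the polyhedral product *)

Section Chart.
Variables (R : realType) (I : finType) (L : {set {set I}}) (n : nat).
Variables (M : I -> topologicalType) (m : I -> nat).
Let B i := manifold_boundary R (m i).+1 (M i).
Let Z := polyhedral_product L B.
Variables (kappa : {ptws I -> R} -> 'rV[R]_n) (lam : 'rV[R]_n -> {ptws I -> R}).
Hypotheses (lamK : forall t, cone L t -> lam (kappa t) = t)
  (kappaK : forall w, cone L (lam w) /\ kappa (lam w) = w)
  (kappac : {within cone L, continuous kappa})
  (lamc : continuous lam).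
Variables (U : forall i, set (M i)) (f : forall i, M i -> 'rV[R]_(m i).+1)
  (O : forall i, set 'rV[R]_(m i).+1) (g : forall i, 'rV[R]_(m i).+1 -> M i).
Arguments U : clear implicits.
Arguments f : clear implicits.
Arguments O : clear implicits.
Arguments g : clear implicits.
Hypotheses (oU : forall i, open (U i)) (oO : forall i, open (O i))
  (fO : forall i x, U i x -> (O i `&` half_space R (m i).+1) (f i x) /\ g i (f i x) = x)
  (gU : forall i y, (O i `&` half_space R (m i).+1) y -> U i (g i y) /\ f i (g i y) = y)
  (fc : forall i, {within U i, continuous (f i)})
  (gc : forall i, {within O i `&` half_space R (m i).+1, continuous (g i)}).

Let fU i : half_space_chart (U i) (f i).
Proof. by split=> //; exists (O i) => //; exists (g i); split; auto. Qed.

(** Its cardinal, the sum of the [m i] plus [n], is the dimension of the chart: [n] coordinates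
    replace the heights. *)
Definition chart_index := ({i : I & 'I_(m i)} + 'I_n)%type.

Let height (x : prod_topology M) : {ptws I -> R} := fun i => f i (x i) ord0 ord0.

(* A point is recorded by its chart coordinates other than the heights, and by
   the image of the heights under [kappa]. *)
Let phi (z : Z) : 'rV[R]_#|{: chart_index}| := \row_k
  match enum_val k with
  | inl p => f (tag p) (set_val z (tag p)) ord0 (lift ord0 (tagged p))
  | inr b => kappa (height (set_val z)) ord0 b
  end.

Let w_of (v : 'rV[R]_#|{: chart_index}|) : 'rV[R]_n :=
  \row_b v ord0 (enum_rank (inr b : chart_index)).

(** Inverts [phi] at the level of chart coordinates; slot 0 receives the height recovered by
    [lam]. *)
Let y_of (v : 'rV[R]_#|{: chart_index}|) i : 'rV[R]_(m i).+1 := \row_a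
  if unlift ord0 a is Some b
  then v ord0 (enum_rank (inl (Tagged (fun i => 'I_(m i)) b) : chart_index))
  else lam (w_of v) i.

Let x_of v : prod_topology M := fun i => g i (y_of v i).

Let dom : set Z := [set z | forall i, U i (set_val z i)].
(** Only the open sets [O i] are imposed, which makes [cod] open; the half-space condition is
    automatic, as [lam] takes values in the cone. *)
Let cod := [set v | forall i, O i (y_of v i)].

(** Invariance of the boundary enters here: membership in [B i] is read off from the height in the
    chosen chart. *)
Let SuppE x : (forall i, U i (x i)) -> Supp B x = finset (fun i => height x i != 0).
Proof.
move=> Ux; apply/setP => i; rewrite !finset.in_set; apply/idP/idP => [|hx].
  rewrite notin_setE => xB; apply/eqP => hx; apply: xB.
  exact/(manifold_boundaryP (fU i) (Ux i))/half_space_boundaryS.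
rewrite notin_setE => /(manifold_boundaryP (fU i) (Ux i))/half_space_boundaryS hx0.
by rewrite /height hx0 eqxx in hx.
Qed.

Let cone_height z : dom z -> cone L (height (set_val z)).
Proof.
move=> Uz; split=> [i|]; first by have [[_ /half_spaceS]] := fO (Uz i).
by rewrite -SuppE //; exact: set_mem (valP z).
Qed.

Let y_phi z : dom z -> forall i, y_of (phi z) i = f i (set_val z i).
Proof.
move=> Uz i; apply/rowP => a; rewrite mxE; case: unliftP => [b ->|->].
  by rewrite mxE enum_rankK.
rewrite (_ : w_of _ = kappa (height (set_val z))) ?lamK //; first exact: cone_height.
by apply/rowP => b; rewrite mxE mxE enum_rankK.
Qed.

Let y0 v i : y_of v i ord0 ord0 = lam (w_of v) i.
Proof. by rewrite mxE unlift_none. Qed.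

Let yH v i : half_space R (m i).+1 (y_of v i).
Proof. by apply/half_spaceS; rewrite y0; have [[l0 _] _] := kappaK (w_of v). Qed.

Let Ux v : cod v -> forall i, U i (x_of v i).
Proof. by move=> vO i; have [] := gU (conj (vO i) (@yH v i)). Qed.

Let fx v : cod v -> forall i, f i (x_of v i) = y_of v i.
Proof. by move=> vO i; have [] := gU (conj (vO i) (@yH v i)). Qed.

Let hx v : cod v -> height (x_of v) = lam (w_of v).
Proof. by move=> vO; apply/funext => i; rewrite /height fx // y0. Qed.

Let xZ v : cod v -> Z (x_of v).
Proof.
move=> vO; rewrite /Z /polyhedral_product /= SuppE; last exact: Ux.
by rewrite hx //; have [[_ ?] _] := kappaK (w_of v).
Qed.

Lemma polyhedral_product_chart (z0 : Z) : dom z0 -> exists (W : set Z)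
  (V : set 'rV[R]_#|{: chart_index}|), [/\ open W, W z0, open V & homeomorphic W V].
Proof.
move=> z0U.
(* Where [x_of v] leaves [Z] the value falls back on [z0]; this never happens on [cod]. *)
pose psi v : Z := insubd z0 (x_of v).
have psiE v : cod v -> set_val (psi v) = x_of v.
  by move=> /xZ/mem_set xvZ; rewrite /psi; exact: insubdK.
have y_cvg v i : y_of u i @[u --> v] --> y_of v i.
  have wv : w_of u @[u --> v] --> w_of v.
    apply: (@cvg_rV _ R n (nbhs v) w_of (w_of v) (nbhs_filter v)) => b; rewrite mxE.
    under eq_cvg do rewrite mxE.
    exact: (@cvg_coord R _ _ (nbhs v) id v _ _ cvg_id).
  apply: (@cvg_rV _ R _ (nbhs v) (y_of^~ i) (y_of v i) (nbhs_filter v)) => a; rewrite mxE.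
  under eq_cvg do rewrite mxE.
  case: (unlift ord0 a) => [b|]; first exact: (@cvg_coord R _ _ (nbhs v) id v _ _ cvg_id).
  apply: (@cvg_proj _ I (fun=> R) (nbhs v) (fun u => lam (w_of u)) (lam (w_of v)) i).
  exact: (@cvg_comp _ _ _ w_of lam _ _ _ wv (@lamc (w_of v))).
exists dom, cod; split=> //.
- rewrite openE => z Uz.
  have nU i : nbhs z [set u : Z | U i (set_val u i)].
    have zi : set_val u i @[u --> z] --> set_val z i.
      by apply: (@cvg_proj _ _ M (nbhs z)); exact: set_val_continuous.
    by have := zi _ (open_nbhs_nbhs (conj (@oU i) (Uz i))).
  exact: (@filter_forall _ _ _ (nbhs z) _ nU).
- rewrite openE => v Ov.
  have nO i : nbhs v [set u | O i (y_of u i)].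
    by have := y_cvg v i _ (open_nbhs_nbhs (conj (@oO i) (Ov i))).
  exact: (@filter_forall _ _ _ (nbhs v) _ nO).
exists phi, psi; split.
- move=> z Uz; have zO : cod (phi z).
    by move=> i; rewrite y_phi //; have [[]] := fO (Uz i).
  split=> //; apply: val_inj; rewrite [LHS]psiE //.
  by apply: functional_extensionality_dep => i; rewrite /x_of y_phi //; have [] := fO (Uz i).
- move=> v vO; have Upsi : dom (psi v) by move=> i; rewrite psiE //; exact: Ux.
  split=> //; apply/rowP => k; rewrite mxE; case E: (enum_val k) => [[i b]|b].
    rewrite /= psiE // fx // mxE liftK; congr (v _ _).
    by apply: (can_inj enum_valK); rewrite enum_rankK E.
  rewrite psiE // hx //; have [_ ->] := kappaK (w_of v); rewrite mxE; congr (v _ _).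
  by apply: (can_inj enum_valK); rewrite enum_rankK E.
- apply/within_continuousP => z Uz; set G := within _ _.
  have Gdom : \forall u \near G, dom u by exact: withinT.
  have zG : set_val u @[u --> G] --> set_val z.
    have idG : u @[u --> G] --> z by exact: cvg_within.
    exact: (@cvg_comp _ _ _ id (@set_val _ Z) G (nbhs z) _ idG (@set_val_continuous _ Z z)).
  have fG i : f i (set_val u i) @[u --> G] --> f i (set_val z i).
    apply: (@cvg_within_comp _ _ _ G (U i) (fun u => set_val u i) (f i) _ _ (@fc i) (Uz i)).
      exact: (@cvg_proj _ _ M G set_val).
    by apply: filterS Gdom => u; exact.
  have hG : kappa (height (set_val u)) @[u --> G] --> kappa (height (set_val z)).
    apply: (@cvg_within_comp _ _ _ G _ (fun u => height (set_val u)) kappa _ _ kappac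
      (cone_height Uz)).
      by apply: cvg_prod_topology => i; exact: cvg_coord (fG i).
    by apply: filterS Gdom => u; exact: cone_height.
  apply: cvg_rV => k; rewrite mxE.
  under eq_cvg do rewrite mxE.
  by case: (enum_val k) => [[i b]|b]; [exact: cvg_coord (fG i)|exact: cvg_coord hG].
- apply/within_continuousP => v Ov; set G := within _ _.
  have Gcod : \forall u \near G, cod u by exact: withinT.
  apply: cvg_set_type; rewrite psiE //.
  have : x_of u @[u --> G] --> x_of v.
    apply: cvg_prod_topology => i.
    apply: (@cvg_within_comp _ _ _ G _ (fun u => y_of u i) (g i) _ _ (@gc i)
      (conj (Ov i) (@yH v i))).
      have idG : u @[u --> G] --> v by exact: cvg_within.
      exact: (@cvg_comp _ _ _ id (y_of^~ i) G (nbhs v) _ idG (y_cvg v i)).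
    by apply: filterS Gcod => u Ou; split=> //; exact: yH.
  apply: cvg_trans; apply: near_eq_cvg.
  by apply: filterS Gcod => u Ou; rewrite psiE.
Qed.
End Chart.

(** * Global structure of the polyhedral product *)

Lemma half_space_boundary_dim_gt0 (R : realType) n (v : 'rV[R]_n) :
  half_space_boundary R n v -> (0 < n)%N.
Proof. by move=> [j _]; exact: leq_ltn_trans (ltn_ord j). Qed.

Lemma polyhedral_product_manifold (R : realType) (I : finType) (L : {set {set I}})
    (M : I -> topologicalType) (m : I -> nat) :
  simplicial_complex L ->
  (forall i, manifold_with_boundary R (m i).+1 (M i)) ->
  triangulates_sphere R L ->
  let Z := polyhedral_product L (fun i => manifold_boundary R (m i).+1 (M i)) in
  exists d : nat,
    topological_manifold R d Z /\
    ((forall i, compact [set: M i]) -> closed_manifold R d Z).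
Proof.
move=> Lsc mM [n LS] Z; have [L0 _ _] := Lsc.
have [kappa [lam [lamK kappaK kappac lamc]]] := cone_homeomorphic L0 LS.
have Zman : topological_manifold R #|{: chart_index n m}| Z.
  split.
  - by apply: hausdorff_set_type; apply: hausdorff_product => i; have [] := mM i.
  - by apply: second_countable_set_type; apply: second_countable_prod => i; have [] := mM i.
  move=> z.
  (* Domain, chart, open set and inverse are packed into one tuple, so that a single choice over [I]
     yields all four families. *)
  pose is_chart i (p : set (M i) * (M i -> 'rV[R]_(m i).+1) *
      (set 'rV[R]_(m i).+1 * ('rV[R]_(m i).+1 -> M i))) :=
    [/\ open p.1.1, p.1.1 (set_val z i), open p.2.1 &
    [/\ forall x, p.1.1 x -> (p.2.1 `&` half_space R (m i).+1) (p.1.2 x) /\ p.2.2 (p.1.2 x) = x,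
      forall y, (p.2.1 `&` half_space R (m i).+1) y -> p.1.1 (p.2.2 y) /\ p.1.2 (p.2.2 y) = y,
      {within p.1.1, continuous p.1.2} &
      {within p.2.1 `&` half_space R (m i).+1, continuous p.2.2}]].
  have ch i : exists p, is_chart i p.
    have [_ _ /(_ (set_val z i))[U [f [Uz [oU [ O oO [g gP]]]]]]] := mM i.
    by exists ((U, f), (O, g)).
  have [p pP] : exists p, forall i, is_chart i (p i).
    by exists (fun i => projT1 (cid (ch i))) => i; exact: projT2 (cid (ch i)).
  apply: (@polyhedral_product_chart R I L n M m kappa lam _ _ _ _
    (fun i => (p i).1.1) (fun i => (p i).1.2) (fun i => (p i).2.1) (fun i => (p i).2.2)).
  - by move=> t /lamK[].
  - by move=> w; apply: kappaK.
  - exact: kappac.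
  - exact/continuous_subspace_setT.
  - by move=> i; have [+ _ _ _] := pP i; exact.
  - by move=> i; have [_ _ + _] := pP i; exact.
  - by move=> i; have [_ _ _ [+ _ _ _]] := pP i; exact.
  - by move=> i; have [_ _ _ [_ + _ _]] := pP i; exact.
  - by move=> i; have [_ _ _ [_ _ + _]] := pP i; exact.
  - by move=> i; have [_ _ _ [_ _ _ +]] := pP i; exact.
  - by move=> i; have [_ + _ _] := pP i; exact.
exists #|{: chart_index n m}|; split; first exact: Zman.
move=> Mc; split; first exact: Zman.
apply: compact_set_type.
apply: (subclosed_compact _ (tychonoff Mc)) => //.
by apply: closed_polyhedral_product => // i; exact: closed_manifold_boundary.
Qed.

(** The factors are not assumed compact, so closed is read as locally Euclidean at every point, with
    compactness added when every factor is compact. *)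
Theorem proposition4p3 (R : realType) (I : finType) (L : {set {set I}})
    (M : I -> topologicalType) (m : I -> nat) :
  simplicial_complex L ->
  (forall i, manifold_with_boundary R (m i) (M i)) ->
  (forall i, path_connected R (M i)) ->
  (forall i, manifold_boundary R (m i) (M i) !=set0) ->
  triangulates_sphere R L ->
  let Z := polyhedral_product L (fun i => manifold_boundary R (m i) (M i)) in
  exists d : nat,
    topological_manifold R d Z /\
    ((forall i, compact [set: M i]) -> closed_manifold R d Z).
Proof.
move=> Lsc mM _ bM LS.
pose m' i := (m i).-1.
(* A boundary point has a vanishing first coordinate, so each [m i] is positive and can be written
   as a successor. *)
have mE : m = fun i => (m' i).+1.
  apply/funext => i; have [x [U [f [_ _ /half_space_boundary_dim_gt0 m0]]]] := bM i.
  by rewrite prednK.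
clearbody m'; subst m.
exact: polyhedral_product_manifold.
Qed.
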